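(* Let $f_1,\dots,f_m:\mathbb{R}^n\to\mathbb{R}$ be convex and differentiable, with $\nabla f_i$ Lipschitz continuous with constant $L_i$. Let $W\in\mathbb{R}^{m\times m}$ be a mixing matrix, let $0\le\beta<\frac{1+\lambda_{\min}(W)}{2}$, let $$0<\alpha<\frac{1-2\beta+\lambda_{\min}(W)}{\max_i\{L_i\}}$$ be a fixed stepsize, and let $(X^k)_{k\ge0}$ be generated by the decentralized Heavy-ball method $$X^{k+1}=WX^k-\alpha\nabla f(X^k)+\beta(X^k-X^{k-1}).$$ Then $$F(X^k)-\min F=O\left(\frac1k\right)\qquad(k\to\infty),$$ where $F(X)=f(X)+\frac{1}{2\alpha}\operatorname{tr}\left(X^\top(I-W)X\right)$.
   Context: $X=(x(1),\dots,x(m))^\top\in\mathbb{R}^{m\times n}$ collects local copies $x(i)\in\mathbb{R}^n$ as rows; $f(X):=\sum_{i=1}^m f_i(x(i))$, so $\nabla f(X)\in\mathbb{R}^{m\times n}$ has $i$-th row $\nabla f_i(x(i))^\top$. $I$ is the identity matrix and $\lambda_{\min}(W)$ is the smallest eigenvalue of $W$. A mixing matrix of a connected network of $m$ nodes is a symmetric doubly stochastic matrix $W=(w_{i,j})$ with $w_{i,j}=0$ when $j\ne i$ is not a neighbor of $i$ (so $I-W$ is positive semidefinite). The notation $\min F$ presupposes that the minimum of $F$ over $\mathbb{R}^{m\times n}$ is attained. The iteration is run for $k\ge0$ from arbitrary initial points $X^{-1},X^0$. The method is the Heavy-ball method $X^{k+1}=X^k-\alpha\nabla F(X^k)+\beta(X^k-X^{k-1})$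 applied to $F$. *)

(* Defs.v *)
From mathcomp Require Import all_boot all_order all_algebra.
From mathcomp Require Import boolp classical_sets reals ereal topology normedtype.
From mathcomp Require Import landau derive convex.

Set Implicit Arguments.
Unset Strict Implicit.
Unset Printing Implicit Defensive.

Import Order.TTheory GRing.Theory Num.Theory.
Import numFieldTopology.Exports numFieldNormedType.Exports.

Local Open Scope classical_set_scope.
Local Open Scope ring_scope.

Definition is_minimum (R : realType) (A : set R) (v : R) : Prop :=
  A v /\ lbound A v.

(* The canonical norm on ['rV[R]_n] is the sup norm, hence this definition. *)
Definition enorm (R : realType) (n : nat) (u : 'rV[R]_n) : R :=
  Num.sqrt (\sum_j u 0 j ^+ 2).

Definition gradient (R : realType) (n : nat) (g : 'rV[R]_n -> R)
    (x : 'rV[R]_n) : 'rV[R]_n :=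
  \row_j 'D_(delta_mx 0 j) g x.

Definition lipschitz_gradient (R : realType) (n : nat) (L : R)
    (g : 'rV[R]_n -> R) : Prop :=
  0 <= L /\
  forall x y, enorm (gradient g x - gradient g y) <= L * enorm (x - y).

Definition connected_network (m : nat) (e : rel 'I_m) : Prop :=
  [/\ symmetric e, irreflexive e & forall i j, connect e i j].

Definition doubly_stochastic (R : realType) (m : nat) (W : 'M[R]_m) : Prop :=
  [/\ forall i j, 0 <= W i j,
      forall i, \sum_j W i j = 1
    & forall j, \sum_i W i j = 1].

Definition mixing_matrix (R : realType) (m : nat) (e : rel 'I_m)
    (W : 'M[R]_m) : Prop :=
  [/\ W^T = W, doubly_stochastic W
    & forall i j, j != i -> ~~ e i j -> W i j = 0].

(* [eigenvalue] refers to row eigenvectors; it is only applied to symmetric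
   matrices, for which row and column eigenvalues agree. *)
Definition is_lambda_min (R : realType) (m : nat) (W : 'M[R]_m) (l : R) : Prop :=
  is_minimum [set a | eigenvalue W a] l.

Definition sum_obj (R : realType) (m n : nat) (f : 'I_m -> 'rV[R]_n -> R)
    (X : 'M[R]_(m, n)) : R :=
  \sum_i f i (row i X).

Definition sum_obj_grad (R : realType) (m n : nat) (f : 'I_m -> 'rV[R]_n -> R)
    (X : 'M[R]_(m, n)) : 'M[R]_(m, n) :=
  \matrix_i gradient (f i) (row i X).

Definition penalized_obj (R : realType) (m n : nat)
    (f : 'I_m -> 'rV[R]_n -> R) (W : 'M[R]_m) (alpha : R)
    (X : 'M[R]_(m, n)) : R :=
  sum_obj f X + 1 / (2 * alpha) * \tr (X^T *m (1%:M - W) *m X).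

(* [Xm1] plays the role of X^{-1}, so that [prev Xm1 X k] is X^{k-1}. *)
Definition prev (T : Type) (Xm1 : T) (X : nat -> T) (k : nat) : T :=
  if k is j.+1 then X j else Xm1.

Definition decentralized_heavy_ball (R : realType) (m n : nat)
    (f : 'I_m -> 'rV[R]_n -> R) (W : 'M[R]_m) (alpha beta : R)
    (Xm1 : 'M[R]_(m, n)) (X : nat -> 'M[R]_(m, n)) : Prop :=
  forall k : nat,
    X k.+1 = W *m X k - alpha *: sum_obj_grad f (X k)
             + beta *: (X k - prev Xm1 X k).

(* The quotient is taken in [\bar R], where [c / 0 = +oo] for [0 < c]: if all
   the [L i] vanish, the stepsize is not bounded from above. [0] is neutral for
   the maximum of the nonnegative constants [L i]. *)
Definition stepsize_bound (R : realType) (m : nat) (L : 'I_m -> R)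
    (beta lmin : R) : \bar R :=
  ((1 - 2 * beta + lmin)%:E / (\big[Num.max/0]_i L i)%:E)%E.

(* Main.v *)
Require Import Defs.
From mathcomp Require Import all_boot all_order all_algebra.
From mathcomp Require Import boolp classical_sets reals ereal topology normedtype.
From mathcomp Require Import landau derive convex.
From mathcomp Require Import functions ring lra.

Import Order.TTheory GRing.Theory Num.Theory.
Import numFieldTopology.Exports numFieldNormedType.Exports.

Local Open Scope classical_set_scope.
Local Open Scope ring_scope.

(** Write [G] for the gradient of [F = penalized_obj f W alpha]; the
    decentralized iteration is the heavy-ball method
    [X (k+1) = X k - alpha G (X k) + beta D k], [D k = X k - X (k-1)], for [F].

    Two properties of [F] are needed. It lies above its tangents
    ([penalized_tangent_le]): each [f i] is convex, and [I - W] is positive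
    semidefinite because [W] is doubly stochastic. And it satisfies the descent
    inequality with constant [M = max L i + (1 - lmin) / alpha]
    ([penalized_descent]): the first summand comes from the Lipschitz gradients,
    the second from the Rayleigh bound [lmin |u|^2 <= u W u^T] ([rayleigh_le]).
    The stepsize condition says exactly that [alpha M < 2 (1 - beta)].

    The rate ([heavy_ball_rate]) then follows from two Lyapunov functions.
    The energy [E k = alpha (F (X k) - min F) + beta / 2 |D k|^2] decreases, by
    at least a positive multiple of [|D (k+1)|^2]; this is the descent inequality
    in which [alpha G (X k)] is replaced by [beta D k - D (k+1)]. For the second,
    the vector [U k = (1 - beta) (X k - Xs) + beta D k], where [Xs] is a
    minimizer, performs plain gradient steps, [U (k+1) = U k - alpha G (X k)].
    Expanding [|U (k+1)|^2] and using the tangent inequalities towards [Xs] and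
    towards [X (k-1)], one finds that [|U k|^2] decreases by a multiple of
    [F (X k) - min F], up to a telescoping term and multiples of [|D k|^2] and
    [|D (k+1)|^2]. Adding a large multiple of [E] absorbs these errors and gives
    a nonnegative potential [P] with [P (k+1) + 2 (1 - beta) E k <= P k]. So [E]
    is summable, and a nonincreasing summable sequence is [O(1/k)]. *)

(** * The Frobenius inner product *)

(** On row vectors this is the Euclidean inner product behind [enorm]. *)
Definition frob {R : realType} {m n : nat} (A B : 'M[R]_(m, n)) : R :=
  \tr (A^T *m B).

Section Frobenius.
Context {R : realType} {m n : nat}.
Implicit Types A B C : 'M[R]_(m, n).

Lemma frobE A B : frob A B = \sum_i \sum_j A i j * B i j.
Proof.
rewrite /frob /mxtrace exchange_big; apply: eq_bigr => j _.
by rewrite mxE; apply: eq_bigr => i _; rewrite mxE.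
Qed.

Lemma frobC A B : frob A B = frob B A.
Proof. by rewrite /frob -mxtrace_tr trmx_mul trmxK. Qed.

Lemma frobDr A B C : frob A (B + C) = frob A B + frob A C.
Proof. by rewrite /frob mulmxDr mxtraceD. Qed.

Lemma frobNr A B : frob A (- B) = - frob A B.
Proof. by rewrite /frob mulmxN raddfN. Qed.

Lemma frobZr a A B : frob A (a *: B) = a * frob A B.
Proof. by rewrite /frob -scalemxAr mxtraceZ. Qed.

Lemma frobDl A B C : frob (A + B) C = frob A C + frob B C.
Proof. by rewrite frobC frobDr !(frobC C). Qed.

Lemma frobNl A B : frob (- A) B = - frob A B.
Proof. by rewrite frobC frobNr frobC. Qed.

Lemma frobZl a A B : frob (a *: A) B = a * frob A B.
Proof. by rewrite frobC frobZr frobC. Qed.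

Lemma frob_sqrD A B :
  frob (A + B) (A + B) = frob A A + 2 * frob A B + frob B B.
Proof. by rewrite frobDl !frobDr (frobC B A); ring. Qed.

Lemma frob_sqrB A B :
  frob (A - B) (A - B) = frob A A - 2 * frob A B + frob B B.
Proof. by rewrite frob_sqrD !(frobNl, frobNr); ring. Qed.

Lemma frob_ge0 A : 0 <= frob A A.
Proof.
by rewrite frobE; do 2!apply: sumr_ge0 => ? _; rewrite -expr2 sqr_ge0.
Qed.

Lemma frob_eq0 A : (frob A A == 0) = (A == 0).
Proof.
apply/idP/eqP => [|->]; last by rewrite /frob mulmx0 raddf0 eqxx.
rewrite frobE psumr_eq0 => [/allP A0|i _]; last first.
  by apply: sumr_ge0 => j _; rewrite -expr2 sqr_ge0.
apply/matrixP => i j; rewrite mxE.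
have /= := A0 i (mem_index_enum i).
rewrite psumr_eq0 => [/allP/(_ j (mem_index_enum j))/=|k _].
  by rewrite -expr2 sqrf_eq0 => /eqP.
by rewrite -expr2 sqr_ge0.
Qed.

Lemma frob_gt0 A : (0 < frob A A) = (A != 0).
Proof. by rewrite lt_def frob_eq0 frob_ge0 andbT. Qed.

Lemma frob_mulmx (S : 'M[R]_m) A B : frob A (S *m B) = frob (S^T *m A) B.
Proof. by rewrite /frob trmx_mul trmxK mulmxA. Qed.

End Frobenius.

Lemma frob_row {R : realType} {m n : nat} (A B : 'M[R]_(m, n)) :
  frob A B = \sum_i frob (row i A) (row i B).
Proof.
rewrite frobE; apply: eq_bigr => i _; rewrite frobE big_ord1.
by apply: eq_bigr => j _; rewrite !mxE.
Qed.

Lemma frob_tr {R : realType} {m n : nat} (A B : 'M[R]_(m, n)) :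
  frob A^T B^T = frob A B.
Proof. by rewrite /frob mxtrace_mulC -trmx_mul mxtrace_tr. Qed.

Lemma enorm_sqr {R : realType} {n : nat} (u : 'rV[R]_n) :
  enorm u ^+ 2 = frob u u.
Proof.
rewrite /enorm sqr_sqrtr; last by apply: sumr_ge0 => j _; rewrite sqr_ge0.
by rewrite frobE big_ord1; apply: eq_bigr => j _; rewrite expr2.
Qed.

Lemma enorm_ge0 {R : realType} {n : nat} (u : 'rV[R]_n) : 0 <= enorm u.
Proof. exact: sqrtr_ge0. Qed.

Lemma enormZ {R : realType} {n : nat} (c : R) (v : 'rV[R]_n) :
  enorm (c *: v) = `|c| * enorm v.
Proof.
rewrite /enorm -sqrtr_sqr -sqrtrM ?sqr_ge0// mulr_sumr; congr Num.sqrt.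
by apply: eq_bigr => j _; rewrite mxE exprMn.
Qed.

(** The form in which the Cauchy-Schwarz inequality is used: it turns a Lipschitz
    estimate of [u] along [v] into a bound on their inner product. *)
Lemma frob_le_of_enorm_le {R : realType} {n : nat} (u v : 'rV[R]_n) (c : R) :
  enorm u <= c * enorm v -> frob u v <= c * frob v v.
Proof.
move=> uv; have cv0 : 0 <= c * enorm v := le_trans (enorm_ge0 u) uv.
have : enorm u ^+ 2 <= (c * enorm v) ^+ 2.
  by rewrite ler_pXn2r ?nnegrE// enorm_ge0.
rewrite exprMn !enorm_sqr => uv2.
have [cv|cv] := eqVneq (c * enorm v) 0.
  have /eqP -> : u == 0.
    rewrite -frob_eq0 eq_le frob_ge0 andbT (le_trans uv2)//.
    by rewrite -enorm_sqr -exprMn cv expr0n.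
  rewrite /frob trmx0 mul0mx raddf0 -/(frob v v).
  by rewrite -enorm_sqr expr2 mulrA cv mul0r.
have c0 : 0 < c.
  move: cv; rewrite ltNge; apply: contra => c0.
  by rewrite eq_le cv0 andbT mulr_le0_ge0// enorm_ge0.
rewrite -(ler_pM2l c0); have := frob_ge0 (u - c *: v).
by rewrite frob_sqrB !(frobZl, frobZr); lra.
Qed.

(** * Quadratic forms of the mixing matrix *)

(** The quadratic form of [S] on matrices with [m] rows is the sum of its values
    on the columns, so form inequalities only have to be checked on vectors. They
    are stated for row vectors, because [eigenvalue] is about row vectors. *)
Lemma frob_rows_le {R : realType} {m n : nat} (S T : 'M[R]_m) (A : 'M[R]_(m, n)) :
  (forall u : 'rV[R]_m, frob u (u *m S) <= frob u (u *m T)) ->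
  S^T = S -> T^T = T -> frob A (S *m A) <= frob A (T *m A).
Proof.
move=> ST Ss Ts; rewrite -[leLHS]frob_tr -[leRHS]frob_tr !trmx_mul Ss Ts.
rewrite frob_row [leRHS]frob_row; apply: ler_sum => i _.
by rewrite !row_mul; exact: ST.
Qed.

(** From [u_i u_j <= (u_i^2 + u_j^2) / 2]: summed against [W], each of the two
    halves gives [|u|^2 / 2] because the rows and the columns sum to [1]. *)
Lemma doubly_stochastic_le {R : realType} {m : nat} (W : 'M[R]_m) (u : 'rV[R]_m) :
  doubly_stochastic W -> frob u (u *m W) <= frob u u.
Proof.
case=> W0 Wr Wc; rewrite !frobE !big_ord1.
have -> : \sum_j u 0 j * (u *m W) 0 j = \sum_j \sum_i W i j * (u 0 i * u 0 j).
  by apply: eq_bigr => j _; rewrite mxE mulr_sumr; apply: eq_bigr => i _; ring.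
apply: (@le_trans _ _ (\sum_j \sum_i (W i j * (u 0 i * u 0 i / 2) +
                                      W i j * (u 0 j * u 0 j / 2)))).
  apply: ler_sum => j _; apply: ler_sum => i _; rewrite -mulrDr.
  by apply: ler_wpM2l => //; have := sqr_ge0 (u 0 i - u 0 j); lra.
under eq_bigr do rewrite big_split/= -(mulr_suml _ _ (fun i => W i _)) Wc mul1r.
rewrite big_split/= exchange_big/=.
under eq_bigr do rewrite -mulr_suml Wr mul1r.
by rewrite -big_split/=; apply: ler_sum => j _; lra.
Qed.

Lemma rayleigh_continuous {R : realType} {m : nat} (S : 'M[R]_m) :
  continuous (fun u : 'rV[R]_m => frob u (u *m S)).
Proof.
have -> : (fun u : 'rV[R]_m => frob u (u *m S)) =
    (fun u => \sum_j u 0 j * \sum_i u 0 i * S i j).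
  apply/funext => u; rewrite frobE big_ord1.
  by apply: eq_bigr => j _; rewrite mxE.
have coordC j : continuous (fun u : 'rV[R]_m => u 0 j).
  exact: coord_continuous.
have rowC j : continuous (fun u : 'rV[R]_m => \sum_i u 0 i * S i j).
  apply: (continuous_big add_continuous) => i _ u.
  by apply: continuousM; [exact: coordC|exact: cst_continuous].
apply: (continuous_big add_continuous) => j _ u.
by apply: continuousM; [exact: coordC|exact: rowC].
Qed.

Lemma unit_sphere_compact {R : realType} {m : nat} :
  compact [set u : 'rV[R]_m | frob u u = 1].
Proof.
apply: bounded_closed_compact.
  exists 1; split; first exact: num_real.
  move=> M M1 u /= u1; apply: le_trans (ltW M1).
  rewrite [leLHS]/Num.norm/= mx_normrE.
  apply/bigmax_leP; split => // -[i j] _ /=.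
  rewrite ord1 -(ler_pXn2r (n := 2))// ?nnegrE// expr1n -u1 frobE big_ord1.
  rewrite real_normK ?num_real// (bigD1 j)//= -expr2 lerDl.
  by apply: sumr_ge0 => k _; rewrite -expr2 sqr_ge0.
rewrite (_ : mkset _ = (fun u : 'rV[R]_m => frob u (u *m 1%:M)) @^-1` [set 1]).
  apply: preimage_closed => [u _|]; first exact: rayleigh_continuous.
  exact: closed_eq.
by apply/seteqP; split => u; rewrite /= mulmx1.
Qed.

(** The values at [v + t w], with [w = v S], are [2 t |w|^2 + O(t^2)]; they would be
    negative for small [t < 0] if [w] were nonzero. *)
Lemma psd_isotropic {R : realType} {m : nat} (S : 'M[R]_m) (v : 'rV[R]_m) :
  S^T = S -> (forall u : 'rV[R]_m, 0 <= frob u (u *m S)) ->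
  frob v (v *m S) = 0 -> v *m S = 0.
Proof.
move=> Ss S0 v0; set w := v *m S.
have Sw : frob w (v *m S) = frob v (w *m S).
  by rewrite frobC /frob trmx_mul Ss -mulmxA mxtrace_mulC mulmxA.
apply/eqP; rewrite -frob_eq0.
have b0 := frob_ge0 w; set b := frob w w in b0 *.
have c0 := S0 w; set c := frob w (w *m S) in c0.
have q t : 0 <= 2 * t * b + t ^+ 2 * c.
  have := S0 (v + t *: w).
  rewrite mulmxDl -scalemxAl frobDl !frobDr !frobZl !frobZr v0 -Sw -/w -/b -/c.
  by lra.
have c1 : 0 < c + 1 by lra.
(* The minimizer in [t] is [- b / c]; adding [1] avoids the case [c = 0]. *)
have := q (- b / (c + 1)).
have -> : 2 * (- b / (c + 1)) * b + (- b / (c + 1)) ^+ 2 * c =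
   - (b ^+ 2 * ((c + 2) / (c + 1) ^+ 2)).
  by field; rewrite gt_eqF.
have p : 0 < (c + 2) / (c + 1) ^+ 2 by rewrite divr_gt0 ?exprn_gt0//; lra.
rewrite oppr_ge0 pmulr_lle0// => b2.
by rewrite -sqrf_eq0 eq_le b2 sqr_ge0.
Qed.

(** The minimum [mu] of the Rayleigh quotient is attained on the unit sphere, by
    compactness. At a minimizer [v] the positive semidefinite form of [W - mu I]
    vanishes, so [v] is an eigenvector for [mu], whence [l <= mu]. *)
Lemma rayleigh_le {R : realType} {m : nat} (W : 'M[R]_m) (l : R) :
  W^T = W -> lbound [set a | eigenvalue W a] l ->
  forall u : 'rV[R]_m, l * frob u u <= frob u (u *m W).
Proof.
move=> Ws l_lb u.
have [->|u0] := eqVneq u 0; first by rewrite mul0mx /frob mulmx0 raddf0 mulr0.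
pose nrm (w : 'rV[R]_m) := (Num.sqrt (frob w w))^-1 *: w.
have nrmP (w : 'rV[R]_m) : w != 0 -> frob (nrm w) (nrm w) = 1.
  move=> w0; rewrite /nrm frobZl frobZr mulrA -expr2 exprVn sqr_sqrtr ?frob_ge0//.
  by rewrite mulVf// frob_eq0.
have [v v1 vmin] := EVT_min_rV (ex_intro _ (nrm u) (nrmP u u0))
  (@unit_sphere_compact R m)
  (continuous_subspaceT (@rayleigh_continuous R m W)).
rewrite inE/= in v1.
set mu := frob v (v *m W) in vmin.
have mu_le (w : 'rV[R]_m) : mu * frob w w <= frob w (w *m W).
  have [->|w0] := eqVneq w 0; first by rewrite mul0mx /frob mulmx0 raddf0 mulr0.
  have := vmin (nrm w); rewrite inE/= => /(_ (nrmP w w0)).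
  rewrite /nrm -scalemxAl frobZl frobZr mulrA -expr2 exprVn sqr_sqrtr ?frob_ge0//.
  by rewrite mulrC ler_pdivlMr ?frob_gt0.
have sub (w : 'rV[R]_m) : w *m (W - mu%:M) = w *m W - mu *: w.
  by rewrite mulmxBr mul_mx_scalar.
have eig : v *m (W - mu%:M) = 0.
  apply: psd_isotropic.
      by rewrite linearB/= Ws tr_scalar_mx.
    by move=> w; rewrite sub frobDr frobNr frobZr subr_ge0.
  by rewrite sub frobDr frobNr frobZr v1 mulr1 subrr.
apply: le_trans (mu_le u); apply: ler_wpM2r; first exact: frob_ge0.
apply: l_lb; apply/eigenvalueP; exists v.
  by apply/eqP; rewrite -subr_eq0 -sub eig.
by rewrite -frob_eq0 v1 oner_eq0.
Qed.

Lemma eigenvalue_le1 {R : realType} {m : nat} (W : 'M[R]_m) (a : R) :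
  doubly_stochastic W -> eigenvalue W a -> a <= 1.
Proof.
move=> Wds /eigenvalueP[v vW v0].
have := doubly_stochastic_le _ v Wds.
by rewrite vW frobZr -{2}(mul1r (frob v v)) ler_pM2r ?frob_gt0.
Qed.

(** * Convex functions with Lipschitz gradient *)

Lemma derive_gradient {R : realType} {n : nat} (g : 'rV[R]_n -> R)
    (x v : 'rV[R]_n) :
  differentiable g x -> 'D_v g x = frob (gradient g x) v.
Proof.
move=> dg; rewrite frobE big_ord1 deriveE// {1}(row_sum_delta v) linear_sum.
apply: eq_bigr => j _; rewrite linearZ/= !mxE deriveE//.
exact: mulrC.
Qed.

Lemma is_derive_line {R : realType} {n : nat} (g : 'rV[R]_n -> R)
    (x v : 'rV[R]_n) (t : R) :
  differentiable g (x + t *: v) ->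
  is_derive t 1 (fun s : R => g (x + s *: v)) (frob (gradient g (x + t *: v)) v).
Proof.
move=> dg.
have dl : is_diff t (fun s : R => x + s *: v) (fun s => s *: v).
  have := is_diffD (is_diff_cst x t) (is_diff_scalel t v).
  by move/is_diff_eq; apply; rewrite add0r.
have dgl : differentiable (g \o (fun s : R => x + s *: v)) t.
  by apply: differentiable_comp.
apply: DeriveDef; first exact/diff_derivable.
rewrite deriveE// diff_comp//= diff_val scale1r.
by rewrite -derive_gradient// deriveE.
Qed.

(** By convexity, [g y - g x] bounds the difference quotient of [g] at [x] in the
    direction [y - x] for every step [h] between [0] and [1]. *)
Lemma convex_tangent_le {R : realType} {n : nat} (g : 'rV[R]_n -> R)
    (x y : 'rV[R]_n) :
  convex_function setT g -> differentiable g x ->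
  g x + frob (gradient g x) (y - x) <= g y.
Proof.
move=> cvx dg; rewrite -derive_gradient// addrC -lerBrDr.
have /cvg_dnbhs_at_right dq := @diff_derivable _ _ _ g x (y - x) dg.
rewrite /derive -(cvg_lim _ dq)//.
apply: limr_le; first exact: cvgP dq.
near=> h.
have h0 : 0 < h by near: h; exact: nbhs_right_gt.
have h1 : h < 1 by near: h; exact: nbhs_right_lt.
rewrite /= -[_ *: _]/(h^-1 * _) mulrC ler_pdivrMr//.
have := cvx (Itv01 (ltW h0) (ltW h1)) y x (in_setT _) (in_setT _).
rewrite -[leLHS]/(g (h *: y + (1 - h) *: x)) -[leRHS]/(h * g y + (1 - h) * g x).
have -> : h *: y + (1 - h) *: x = h *: (y - x) + x.
  by apply/matrixP => i j; rewrite !mxE; ring.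
lra.
Unshelve. all: by end_near.
Qed.

Lemma lipschitz_gradient_le {R : realType} {n : nat} (K L : R)
    (g : 'rV[R]_n -> R) :
  K <= L -> lipschitz_gradient K g -> lipschitz_gradient L g.
Proof.
move=> KL [K0 lip]; split; first exact: le_trans KL.
move=> x y; apply: le_trans (lip x y) _; apply: ler_wpM2r KL.
exact: enorm_ge0.
Qed.

(** The mean value theorem applied to [t |-> g (x + t v)], [v = y - x], minus the
    quadratic [q] that would have exactly the largest admissible derivative: the
    derivative of the difference is nonpositive on [0, 1]. *)
Lemma lipschitz_descent {R : realType} {n : nat} (g : 'rV[R]_n -> R) (L : R)
    (x y : 'rV[R]_n) :
  (forall z, differentiable g z) -> lipschitz_gradient L g ->
  g y <= g x + frob (gradient g x) (y - x) + L / 2 * frob (y - x) (y - x).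
Proof.
move=> dg [L0 lip]; set v : 'rV[R]_n := y - x.
set a := frob (gradient g x) v; set b := frob v v.
pose q : {poly R} := a%:P * 'X + (L / 2 * b)%:P * 'X^2.
have qE t : q.[t] = a * t + L / 2 * b * t ^+ 2 by rewrite /q !hornerE; ring.
have dqE t : (deriv q).[t] = a + L * b * t.
  rewrite /q !(derivD, derivM, derivC, derivX, derivXn) !hornerE/=.
  by field.
pose h (t : R) := g (x + t *: v) - q.[t].
have dh (t : R) : is_derive t (1 : R) h
    (frob (gradient g (x + t *: v)) v - (deriv q).[t]).
  have ? := is_derive_line g x v t (dg _).
  exact: is_deriveB.
have [|c c01 hc] := MVT (@ltr01 R) (fun t _ => dh t).
  by apply: derivable_within_continuous => t _; apply: ex_derive.
have c0 : 0 <= c by rewrite (itvP c01).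
have := lip (x + c *: v) x.
rewrite (_ : x + c *: v - x = c *: v); last by rewrite addrC addKr.
rewrite enormZ ger0_norm// mulrA => /frob_le_of_enorm_le.
rewrite frobDl frobNl -/a -/b.
move: hc; rewrite /h !qE dqE scale1r scale0r addr0 subr0 mulr1 (addrC x v) subrK.
by lra.
Qed.

(** * The heavy-ball method for a smooth convex function *)

Section HeavyBallRate.
Context {R : realType} {m n : nat}.
Variables (F : 'M[R]_(m, n) -> R) (G : 'M[R]_(m, n) -> 'M[R]_(m, n)).
Variables (M alpha beta : R).
Variables (Xm1 : 'M[R]_(m, n)) (X : nat -> 'M[R]_(m, n)) (Xs : 'M[R]_(m, n)).
Hypothesis F_convex : forall Y Z : 'M[R]_(m, n), F Y + frob (G Y) (Z - Y) <= F Z.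
Hypothesis F_smooth : forall Y Z : 'M[R]_(m, n),
  F Z <= F Y + frob (G Y) (Z - Y) + M / 2 * frob (Z - Y) (Z - Y).
Hypothesis F_min : forall Y, F Xs <= F Y.
Hypothesis alpha_gt0 : 0 < alpha.
Hypothesis beta_ge0 : 0 <= beta.
Hypothesis beta_lt1 : beta < 1.
Hypothesis step : alpha * M < 2 * (1 - beta).
Hypothesis X_hb : forall k,
  X k.+1 = X k - alpha *: G (X k) + beta *: (X k - Defs.prev Xm1 X k).

Let D k : 'M[R]_(m, n) := X k - Defs.prev Xm1 X k.

Let grad_displacement k : alpha *: G (X k) = beta *: D k - D k.+1.
Proof. by rewrite /D /= X_hb; apply/matrixP => i j; rewrite !mxE; ring. Qed.

(** Scaled by [alpha], so that [grad_displacement] applies without divisions. *)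
Let energy k : R := alpha * (F (X k) - F Xs) + beta / 2 * frob (D k) (D k).
Let gain : R := 1 - beta - alpha * M / 2.

Let gain_gt0 : 0 < gain.
Proof. by rewrite /gain; have := step; lra. Qed.

Let energy_decrease k : energy k.+1 + gain * frob (D k.+1) (D k.+1) <= energy k.
Proof.
have Gd : alpha * frob (G (X k)) (D k.+1) =
    beta * frob (D k) (D k.+1) - frob (D k.+1) (D k.+1).
  by rewrite -frobZl grad_displacement frobDl frobNl frobZl.
have cross : 0 <= beta * (frob (D k) (D k) + frob (D k.+1) (D k.+1)
                          - 2 * frob (D k) (D k.+1)).
  apply: mulr_ge0 => //.
  by have := frob_ge0 (D k - D k.+1); rewrite (frob_sqrB (D k)); lra.
have := F_smooth (X k) (X k.+1).
rewrite -[X k.+1 - X k]/(D k.+1) -(ler_pM2l alpha_gt0) /energy /gain.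
by lra.
Qed.

(** The combination of position and velocity on which the momentum cancels; see
    [shiftedS]. *)
Let shifted k : 'M[R]_(m, n) := (1 - beta) *: (X k - Xs) + beta *: D k.

Let shiftedS k : shifted k.+1 = shifted k - alpha *: G (X k).
Proof.
rewrite grad_displacement /shifted /D /=.
by apply/matrixP => i j; rewrite !mxE; ring.
Qed.

(** The two differences of [F] on the left come from the tangent inequalities at
    [X k] towards the minimizer and towards the previous iterate; the squared
    displacements on the right bound [|alpha G (X k)|^2]. *)
Let shifted_decrease k :
  frob (shifted k.+1) (shifted k.+1)
    + 2 * (1 - beta) * (alpha * (F (X k) - F Xs))
    + 2 * beta * (alpha * (F (X k) - F (Defs.prev Xm1 X k)))
  <= frob (shifted k) (shifted k)
     + 2 * beta ^+ 2 * frob (D k) (D k) + 2 * frob (D k.+1) (D k.+1).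
Proof.
have to_min : alpha * (F (X k) - F Xs) <= alpha * frob (G (X k)) (X k - Xs).
  apply: (ler_wpM2l (ltW alpha_gt0)); have := F_convex (X k) Xs.
  rewrite -(opprB (X k)) frobNr; lra.
have to_prev : alpha * (F (X k) - F (Defs.prev Xm1 X k))
    <= alpha * frob (G (X k)) (D k).
  apply: (ler_wpM2l (ltW alpha_gt0)).
  have := F_convex (X k) (Defs.prev Xm1 X k).
  rewrite -(opprB (X k)) frobNr -/(D k); lra.
have G2 : frob (alpha *: G (X k)) (alpha *: G (X k))
    <= 2 * beta ^+ 2 * frob (D k) (D k) + 2 * frob (D k.+1) (D k.+1).
  have := frob_ge0 (beta *: D k + D k.+1).
  rewrite grad_displacement (frob_sqrD (_ *: _)) (frob_sqrB (_ *: _)).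
  by rewrite !(frobZl, frobZr); lra.
have sG : frob (alpha *: G (X k)) (shifted k) =
    (1 - beta) * (alpha * frob (G (X k)) (X k - Xs))
    + beta * (alpha * frob (G (X k)) (D k)).
  by rewrite /shifted (frobDr _ (_ *: _)) !frobZr !frobZl.
have b1 : 0 <= 1 - beta by rewrite subr_ge0 ltW.
have := ler_wpM2l b1 to_min; have := ler_wpM2l beta_ge0 to_prev.
rewrite shiftedS (frob_sqrB (shifted k)) (frobC (shifted k) (_ *: _)).
move: sG G2; move: (alpha *: G (X k)) => g sG G2.
by rewrite sG; lra.
Qed.

(** Chosen so that [weight * gain] pays for the terms in [|D (k+1)|^2] of
    [potential_decrease]: [2] comes from [shifted_decrease], the rest from the
    displacement term of [potential] at [k+1]. *)
Let weight : R := (2 + 2 * beta ^+ 2 + (1 - beta) * beta) / gain.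

(** The displacement term covers the [|D k|^2] of [shifted_decrease] and the
    kinetic part of [2 (1 - beta) energy k]. *)
Let potential k : R := frob (shifted k) (shifted k)
  + 2 * beta * (alpha * (F (Defs.prev Xm1 X k) - F Xs))
  + (2 * beta ^+ 2 + (1 - beta) * beta) * frob (D k) (D k) + weight * energy k.

Let energy_ge0 k : 0 <= energy k.
Proof.
rewrite addr_ge0// mulr_ge0 ?frob_ge0 ?divr_ge0 ?subr_ge0//; exact: ltW.
Qed.

Let weight_ge0 : 0 <= weight.
Proof.
have b1 : 0 <= 1 - beta by rewrite subr_ge0 ltW.
rewrite divr_ge0 ?(ltW gain_gt0)//.
have := mulr_ge0 b1 beta_ge0; have := sqr_ge0 beta; lra.
Qed.

Let potential_ge0 k : 0 <= potential k.
Proof.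
have b1 : 0 <= 1 - beta by rewrite subr_ge0 ltW.
have a0 : 0 <= alpha * (F (Defs.prev Xm1 X k) - F Xs).
  by rewrite mulr_ge0 ?subr_ge0// ltW.
have := mulr_ge0 (mulr_ge0 b1 beta_ge0) (frob_ge0 (D k)).
have := mulr_ge0 (sqr_ge0 beta) (frob_ge0 (D k)).
have := mulr_ge0 beta_ge0 a0; have := frob_ge0 (shifted k).
have := mulr_ge0 weight_ge0 (energy_ge0 k).
rewrite /potential; move: (frob _ _) (frob _ _) (energy k) => x y z.
by lra.
Qed.

Let potential_decrease k :
  potential k.+1 + 2 * (1 - beta) * energy k <= potential k.
Proof.
have wg : weight * gain = 2 + 2 * beta ^+ 2 + (1 - beta) * beta.
  by rewrite /weight divfK// gt_eqF.
have := ler_wpM2l weight_ge0 (energy_decrease k).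
rewrite mulrDr mulrA wg.
have := shifted_decrease k.
rewrite /potential -[Defs.prev Xm1 X k.+1]/(X k).
have -> : 2 * (1 - beta) * energy k =
    2 * (1 - beta) * (alpha * (F (X k) - F Xs))
    + (1 - beta) * beta * frob (D k) (D k).
  by rewrite /energy; field.
move: (energy k) (energy k.+1) => e e'.
by lra.
Qed.

(** The energy is nonincreasing, so [k] times its [k]-th value is at most the sum of
    the first [k] values, which [potential_decrease] bounds. *)
Lemma heavy_ball_rate : exists C, forall k, k%:R * (F (X k) - F Xs) <= C.
Proof.
have rate k : k%:R * (2 * (1 - beta) * energy k) + potential k <= potential 0.
  elim: k => [|k IH]; first by rewrite mul0r add0r.
  have le_e : energy k.+1 <= energy k.
    apply: le_trans (energy_decrease k).
    by rewrite lerDl mulr_ge0 ?frob_ge0// ltW.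
  have b1 : 0 <= 2 * (1 - beta) by rewrite mulr_ge0// subr_ge0 ltW.
  have := ler_wpM2l (ler0n R k.+1) (ler_wpM2l b1 le_e).
  have := potential_decrease k; rewrite -natr1; lra.
have ab : 0 < 2 * (1 - beta) * alpha by rewrite !mulr_gt0// subr_gt0.
exists (potential 0 / (2 * (1 - beta) * alpha)).
move=> k; rewrite ler_pdivlMr//.
apply: le_trans (rate k).
rewrite -[leLHS]addr0; apply: lerD => //.
rewrite -(mulrA k%:R); apply: ler_wpM2l => //.
rewrite mulrC -(mulrA _ alpha); apply: ler_wpM2l.
  by rewrite mulr_ge0// subr_ge0 ltW.
by rewrite /energy lerDl mulr_ge0 ?divr_ge0 ?frob_ge0.
Qed.

End HeavyBallRate.

(** * The penalized objective *)

Section Penalized.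
Context {R : realType} {m n : nat}.
Implicit Types (f : 'I_m -> 'rV[R]_n -> R) (X Y : 'M[R]_(m, n)).

(** The gradient of [penalized_obj]: the quadratic term has gradient
    [alpha^-1 (I - W) X] because [W] is symmetric. *)
Definition penalized_grad f (W : 'M[R]_m) (alpha : R) X : 'M[R]_(m, n) :=
  sum_obj_grad f X + alpha^-1 *: ((1%:M - W) *m X).

Lemma frob_sum_obj_grad f X Y : frob (sum_obj_grad f X) (Y - X) =
  \sum_i frob (gradient (f i) (row i X)) (row i Y - row i X).
Proof.
rewrite frob_row; apply: eq_bigr => i _.
by rewrite rowK linearB.
Qed.

Lemma sum_obj_tangent_le f X Y :
  (forall i, convex_function setT (f i)) ->
  (forall i x, differentiable (f i) x) ->
  sum_obj f X + frob (sum_obj_grad f X) (Y - X) <= sum_obj f Y.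
Proof.
move=> cvx df; rewrite frob_sum_obj_grad -big_split; apply: ler_sum => i _.
exact: convex_tangent_le.
Qed.

Lemma sum_obj_descent f (L : R) X Y :
  (forall i x, differentiable (f i) x) ->
  (forall i, lipschitz_gradient L (f i)) ->
  sum_obj f Y <= sum_obj f X + frob (sum_obj_grad f X) (Y - X)
                 + L / 2 * frob (Y - X) (Y - X).
Proof.
move=> df lip; rewrite frob_sum_obj_grad (frob_row (Y - X)) mulr_sumr -!big_split.
by apply: ler_sum => i _; rewrite linearB; exact: lipschitz_descent.
Qed.

Lemma quadratic_expansion (S : 'M[R]_m) X Y : S^T = S ->
  frob Y (S *m Y) = frob X (S *m X) + 2 * frob (S *m X) (Y - X)
                    + frob (Y - X) (S *m (Y - X)).
Proof.
move=> Ss; have sym : frob X (S *m (Y - X)) = frob (S *m X) (Y - X).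
  by rewrite frob_mulmx Ss.
rewrite -{1 2}(subrK X Y); move: (Y - X) sym => D sym.
by rewrite mulmxDr frobDl !frobDr sym (frobC D (S *m X)); ring.
Qed.

Lemma penalized_objE f (W : 'M[R]_m) (alpha : R) X :
  penalized_obj f W alpha X =
  sum_obj f X + (2 * alpha)^-1 * frob X ((1%:M - W) *m X).
Proof. by rewrite /penalized_obj div1r /frob mulmxA. Qed.

(** The quadratic part is its own second-order expansion, so the deviation of the
    penalized objective from its tangent is that of the objective plus a
    quadratic form, which the next two lemmas bound from below and from above. *)
Lemma penalized_expansion f (W : 'M[R]_m) (alpha : R) X Y : W^T = W ->
  penalized_obj f W alpha Y - penalized_obj f W alpha X
    - frob (penalized_grad f W alpha X) (Y - X) =
  sum_obj f Y - sum_obj f X - frob (sum_obj_grad f X) (Y - X)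
  + (2 * alpha)^-1 * frob (Y - X) ((1%:M - W) *m (Y - X)).
Proof.
move=> Ws; have Ss : (1%:M - W)^T = 1%:M - W by rewrite linearB/= Ws trmx1.
rewrite !penalized_objE (quadratic_expansion _ X Y Ss).
rewrite (frobDl (sum_obj_grad f X)) frobZl.
by rewrite invfM; move: alpha^-1 => b; field.
Qed.

Lemma penalized_tangent_le f (W : 'M[R]_m) (alpha : R) X Y :
  (forall i, convex_function setT (f i)) ->
  (forall i x, differentiable (f i) x) ->
  W^T = W -> doubly_stochastic W -> 0 <= alpha ->
  penalized_obj f W alpha X + frob (penalized_grad f W alpha X) (Y - X)
  <= penalized_obj f W alpha Y.
Proof.
move=> cvx df Ws Wds a0.
have quad : 0 <= (2 * alpha)^-1 * frob (Y - X) ((1%:M - W) *m (Y - X)).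
  rewrite mulr_ge0 ?invr_ge0 ?mulr_ge0//.
  move: (Y - X) => D; rewrite mulmxBl frobDr frobNr subr_ge0.
  apply: frob_rows_le; rewrite ?trmx1// => u.
  by rewrite mulmx1; exact: doubly_stochastic_le.
have := sum_obj_tangent_le f X Y cvx df.
have := penalized_expansion f W alpha X Y Ws.
lra.
Qed.

Lemma penalized_descent f (W : 'M[R]_m) (alpha L l : R) X Y :
  (forall i x, differentiable (f i) x) ->
  (forall i, lipschitz_gradient L (f i)) ->
  W^T = W -> lbound [set a | eigenvalue W a] l -> 0 < alpha ->
  penalized_obj f W alpha Y <=
    penalized_obj f W alpha X + frob (penalized_grad f W alpha X) (Y - X)
    + (L + (1 - l) / alpha) / 2 * frob (Y - X) (Y - X).
Proof.
move=> df lip Ws l_lb a0.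
have quad : (2 * alpha)^-1 * frob (Y - X) ((1%:M - W) *m (Y - X)) <=
    (1 - l) / alpha / 2 * frob (Y - X) (Y - X).
  have -> : (1 - l) / alpha / 2 * frob (Y - X) (Y - X) =
      (2 * alpha)^-1 * ((1 - l) * frob (Y - X) (Y - X)).
    by field; rewrite gt_eqF.
  apply: ler_wpM2l; first by rewrite invr_ge0 mulr_ge0// ltW.
  move: (Y - X) => D.
  rewrite mulmxBl frobDr frobNr mul1mx mulrBl mul1r lerD2l lerN2.
  rewrite -frobZr -mul_scalar_mx.
  apply: frob_rows_le; rewrite ?tr_scalar_mx// => u.
  by rewrite mul_mx_scalar frobZr; exact: rayleigh_le.
have := sum_obj_descent f L X Y df lip.
have := penalized_expansion f W alpha X Y Ws.
lra.
Qed.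

End Penalized.

(** * The stepsize condition and the rate *)

Lemma lt_stepsize_bound {R : realType} {m : nat} (L : 'I_m -> R)
    (alpha beta l : R) :
  beta < (1 + l) / 2 -> (alpha%:E < stepsize_bound L beta l)%E ->
  alpha * \big[Num.max/0]_i L i < 1 - 2 * beta + l.
Proof.
move=> beta_lt; rewrite /stepsize_bound.
have : 0 <= \big[Num.max/0]_i L i by exact: bigmax_ge_id.
move: (\big[Num.max/0]_i L i) => M; rewrite le_eqVlt => /predU1P[<- _|M0].
  by rewrite mulr0; lra.
by rewrite inver gt_eqF// -EFinM lte_fin ltr_pdivlMr.
Qed.

Theorem corollary2 (R : realType) (m n : nat)
    (f : 'I_m -> 'rV[R]_n -> R) (L : 'I_m -> R)
    (f_convex : forall i, convex_function setT (f i))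
    (f_diff : forall i x, differentiable (f i) x)
    (f_lip : forall i, lipschitz_gradient (L i) (f i))
    (e : rel 'I_m) (e_net : connected_network e)
    (W : 'M[R]_m) (W_mix : mixing_matrix e W)
    (lmin : R) (lminP : is_lambda_min W lmin)
    (beta : R) (beta_ge0 : 0 <= beta) (beta_lt : beta < (1 + lmin) / 2)
    (alpha : R) (alpha_gt0 : 0 < alpha)
    (alpha_lt : (alpha%:E < stepsize_bound L beta lmin)%E)
    (Xm1 : 'M[R]_(m, n)) (X : nat -> 'M[R]_(m, n))
    (X_hb : decentralized_heavy_ball f W alpha beta Xm1 X)
    (Fmin : R) (FminP : is_minimum (range (penalized_obj f W alpha)) Fmin) :
  (fun k : nat => penalized_obj f W alpha (X k) - Fmin)
    =O_\oo (fun k : nat => (k%:R)^-1 : R).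
Proof.
have [Ws Wds _] := W_mix; have [lmin_eig lmin_lb] := lminP.
have [[Xs _ Xs_min] Fmin_lb] := FminP.
pose Lmax := \big[Num.max/0]_i L i.
have lipmax i : lipschitz_gradient Lmax (f i).
  by apply: lipschitz_gradient_le (f_lip i); exact: le_bigmax.
have lmin_le1 := eigenvalue_le1 W lmin Wds lmin_eig.
have beta_lt1 : beta < 1 by lra.
have step : alpha * (Lmax + (1 - lmin) / alpha) < 2 * (1 - beta).
  have := lt_stepsize_bound L alpha beta lmin beta_lt alpha_lt.
  by rewrite -/Lmax mulrDr mulrCA divff ?gt_eqF// mulr1; lra.
have gradient_step k : X k.+1 = X k - alpha *: penalized_grad f W alpha (X k)
    + beta *: (X k - Defs.prev Xm1 X k).
  rewrite X_hb; congr (_ + _).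
  rewrite /penalized_grad scalerDr scalerA divff ?gt_eqF// scale1r.
  rewrite mulmxBl mul1mx.
  by apply/matrixP => i j; rewrite !mxE; ring.
have Xs_le Y : penalized_obj f W alpha Xs <= penalized_obj f W alpha Y.
  by rewrite Xs_min; apply: Fmin_lb; exists Y.
have [C rate] := heavy_ball_rate _ _ _ _ _ _ _ _
  (fun Y Z => penalized_tangent_le f W alpha Y Z f_convex f_diff Ws Wds
                (ltW alpha_gt0))
  (fun Y Z => penalized_descent f W alpha Lmax lmin Y Z f_diff lipmax Ws
                lmin_lb alpha_gt0)
  Xs_le alpha_gt0 beta_ge0 beta_lt1 step gradient_step.
apply/eqOP; near=> c; near=> k.
have k0 : 0 < k%:R :> R by rewrite ltr0n; near: k; exact: nbhs_infty_gt.
rewrite ger0_norm; last by rewrite subr_ge0 -Xs_min.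
rewrite ger0_norm ?invr_ge0 ?ler0n// ler_pdivlMr// mulrC -Xs_min.
apply: le_trans (rate k) _.
by near: c; apply: nbhs_pinfty_ge; exact: num_real.
Unshelve. all: by end_near.
Qed.
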